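(* There exists an absolute constant $c>0$ such that for every positive integer $n$ and every dissociated set $V$ of $n$ distinct positive integers, $$\mathrm{ML}(V)\geqslant \frac{c}{\sqrt{n}}.$$
   Context: Let $\mathbf{T}=\mathbf{R}/\mathbf{Z}$ and let $\lVert x\rVert_{\mathbf{T}}$ denote the distance from $x$ to the nearest integer. For a finite nonempty set $V$ of positive integers, $\mathrm{ML}(V):=\max_{t\in\mathbf{T}}\min_{v\in V}\lVert tv\rVert_{\mathbf{T}}$. A set $D\subseteq\mathbf{Z}$ is dissociated (that is, $1$-dissociated) if whenever $\sum_{d\in D}\varepsilon_d d=0$ for some $\varepsilon_d\in\{-1,0,1\}$, then all $\varepsilon_d=0$. *)

(* Defs.v *)
From mathcomp Require Import all_boot all_order all_algebra finmap.
From mathcomp Require Import all_classical all_reals all_analysis.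
Import Order.TTheory GRing.Theory Num.Theory numFieldNormedType.Exports.

Set Implicit Arguments.
Unset Strict Implicit.
Unset Printing Implicit Defensive.

Local Open Scope classical_set_scope.
Local Open Scope ring_scope.

(* The finiteness condition only matters for infinite D, where the sum must
   have finite support to be meaningful ([\sum_(d \in D)] would otherwise be 0
   by convention). *)
Definition dissociated (D : set int) : Prop :=
  forall eps : int -> int,
    (forall d, D d -> eps d \in [:: -1; 0; 1]) ->
    finite_set [set d | D d /\ eps d != 0] ->
    \sum_(d \in D) eps d * d = 0 ->
    forall d, D d -> eps d = 0.

Section MaxLoneliness.
Variable R : realType.

(* Elements of R/Z are represented by real numbers; [distT] is Z-periodic by
   [distTDz], hence so is [minDist V] by [minDistDz]. *)
Definition distT (x : R) : R := inf [set `|x - k%:~R| | k in [set: int]].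

Definition minDist (V : {fset int}) (t : R) : R :=
  inf [set distT (t * v%:~R) | v in [set` V]].

(* For nonempty V the supremum is attained, see [ML_attained]. *)
Definition ML (V : {fset int}) : R := sup [set minDist V t | t in [set: R]].

Lemma distT_has_inf (x : R) : has_inf [set `|x - k%:~R| | k in [set: int]].
Proof. by split; [exists `|x - 0%:~R|, 0 | exists 0 => _ [k _ <-]]. Qed.

Lemma distT_le (x : R) (k : int) : distT x <= `|x - k%:~R|.
Proof. by apply: ge_inf; [case: (distT_has_inf x) | exists k]. Qed.

Lemma distT_ge0 x : 0 <= distT x.
Proof.
by apply: lb_le_inf; [case: (distT_has_inf x) | move=> _ [k _ <-]].
Qed.

Lemma distT_lip x y : distT x <= distT y + `|x - y|.
Proof.
rewrite -lerBlDr; apply: lb_le_inf; first by case: (distT_has_inf y).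
move=> _ [k _ <-]; rewrite lerBlDr; apply: le_trans (distT_le x k) _.
by rewrite -(subrKA y x) addrC ler_normD.
Qed.

Lemma distTDz x (k : int) : distT (x + k%:~R) = distT x.
Proof.
rewrite /distT; congr inf; apply/seteqP; split=> _ [j _ <-].
  by exists (j - k) => //; rewrite rmorphB opprB addrA.
by exists (j + k) => //; rewrite rmorphD opprD addrACA subrr addr0.
Qed.

Lemma distT_attained x : exists k : int, distT x = `|x - k%:~R|.
Proof.
have [f1 f2] : (Num.floor x)%:~R <= x /\ x < (Num.floor x + 1)%:~R.
  by split; [exact: floor_le | exact: floorD1_gt].
set f := Num.floor x in f1 f2.
suff [k kP] : exists k : int, forall j : int, `|x - k%:~R| <= `|x - j%:~R|.
  exists k; apply/eqP; rewrite eq_le distT_le/=; apply: lb_le_inf.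
    by case: (distT_has_inf x).
  by move=> _ [j _ <-].
have low (j : int) : j <= f -> `|x - f%:~R| <= `|x - j%:~R|.
  move=> jf; have jf' : (j%:~R : R) <= f%:~R by rewrite ler_int.
  by rewrite !ger0_norm ?subr_ge0 ?lerD2l ?lerN2// (le_trans jf').
have high (j : int) : f < j -> `|x - (f + 1)%:~R| <= `|x - j%:~R|.
  rewrite -lezD1 => jf; have jf' : ((f + 1)%:~R : R) <= j%:~R by rewrite ler_int.
  by rewrite !ler0_norm ?subr_le0 ?lerN2 ?lerD2l ?lerN2// ltW// (lt_le_trans f2).
have [le|/ltW le] := leP `|x - f%:~R| `|x - (f + 1)%:~R|.
  by exists f => j; have [/low//|/high] := leP j f; exact: le_trans.
by exists (f + 1) => j; have [/low|/high//] := leP j f; exact: le_trans.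
Qed.

Lemma minDist_le (V : {fset int}) t v :
  v \in V -> minDist V t <= distT (t * v%:~R).
Proof.
move=> vV; apply: ge_inf; last by exists v.
by exists 0 => _ [w _ <-]; exact: distT_ge0.
Qed.

Lemma minDist_attained (V : {fset int}) t : V != fset0 ->
  exists2 v, v \in V & minDist V t = distT (t * v%:~R).
Proof.
case/fset0Pn => v0 v0V.
have [v _ vP] := @arg_minP _ _ V (Sub v0 v0V) predT
  (fun v : V => distT (t * (val v)%:~R)) isT.
exists (val v); first exact: valP.
apply/eqP; rewrite eq_le minDist_le ?(valP v)//=; apply: lb_le_inf.
  by exists (distT (t * v0%:~R)), v0.
by move=> _ [w wV <-]; exact: (vP (Sub w wV) isT).
Qed.

Lemma minDistDz (V : {fset int}) t (k : int) : minDist V (t + k%:~R) = minDist V t.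
Proof.
rewrite /minDist; congr inf; apply/seteqP.
by split=> _ [v vV <-]; exists v => //; rewrite mulrDl -intrM distTDz.
Qed.

Lemma minDist_continuous (V : {fset int}) : V != fset0 -> continuous (minDist V).
Proof.
move=> V0; pose M : R := 1 + \sum_(v : V) `|(val v)%:~R|.
have M0 : 0 < M by rewrite ltr_pwDl// sumr_ge0.
have lip s t : minDist V s <= minDist V t + M * `|s - t|.
  have [v vV ->] := minDist_attained t V0.
  apply: le_trans (minDist_le s vV) _; apply: le_trans (distT_lip _ (t * v%:~R)) _.
  rewrite lerD2l -mulrBl normrM mulrC ler_wpM2r//.
  rewrite /M (bigD1 (Sub v vV : V))//= addrCA lerDl addr_ge0// sumr_ge0//.
move=> t; apply/(@cvgrPdist_lt _ R^o) => e e0; near=> s.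
have st : M * `|t - s| < e.
  rewrite mulrC -ltr_pdivlMr//; near: s.
  by apply: (@cvgr_dist_lt _ R^o); rewrite ?divr_gt0.
rewrite ltr_distl; apply/andP; split.
  by rewrite ltrBlDr (le_lt_trans (lip s t))// ltrD2l distrC.
by rewrite (le_lt_trans (lip t s))// ltrD2l.
Unshelve. all: end_near. Qed.

Lemma ML_attained (V : {fset int}) : V != fset0 ->
  (exists t, ML V = minDist V t) /\ (forall t, minDist V t <= ML V).
Proof.
move=> V0.
have [t _ tP] := @EVT_max R (minDist V) 0 1 ler01
  (continuous_subspaceT (minDist_continuous V0)).
have tmax s : minDist V s <= minDist V t.
  rewrite -(minDistDz V s (- Num.floor s)) tP// in_itv/= rmorphN/= subr_ge0.
  by rewrite floor_le/= lerBlDl -intrD1 ltW// floorD1_gt.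
have hs : has_ubound [set minDist V t | t in [set: R]].
  by exists (minDist V t) => _ [s _ <-].
split; last by move=> s; apply: ub_le_sup => //; exists s.
exists t; apply/eqP; rewrite eq_le; apply/andP; split.
  by apply: ge_sup; [exists (minDist V t), t | move=> _ [s _ <-]].
by apply: ub_le_sup => //; exists t.
Qed.

End MaxLoneliness.

(* Main.v *)
(* Let P(t) be the Riesz product of the factors 1 - cos(2 pi v t), v in V, and
   P_v(t) the same product without the factor of v.  Dissociativity kills every
   non-constant term of the expanded products that could contribute to their
   means, so P and all the P_v have mean 1.  Hence at some t the sum of the P_v
   is less than 2n P; there P_v < 2n (1 - cos(2 pi v t)) P_v, and so
   1 - cos(2 pi v t) > 1/(2n), for every v.  As 1 - cos(2 pi x) is at most
   2 pi^2 ||x||^2, this gives ||t v|| > 1/(2 pi sqrt n).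
   All frequencies in the expansions are smaller than some N, so means over the
   circle can be replaced by means over the points j/N, 0 <= j < N. *)

Require Import Defs.
From mathcomp Require Import all_boot all_order all_algebra finmap.
From mathcomp Require Import all_classical all_reals all_analysis.
From mathcomp Require Import ring lra.
Import Order.TTheory GRing.Theory Num.Theory numFieldNormedType.Exports.

Set Implicit Arguments.
Unset Strict Implicit.
Unset Printing Implicit Defensive.

Local Open Scope ring_scope.

Lemma cosD2piz (R : realType) (x : R) (k : int) :
  cos (x + pi *+ 2 * k%:~R) = cos x.
Proof.
have cosn (y : R) n : cos (y + pi *+ 2 * n%:R) = cos y.
  by rewrite mulr_natr periodicn//; exact: cosD2pi.
case: k => n; first exact: cosn.
by rewrite NegzE rmorphN/= mulrN -[LHS](cosn _ n.+1) subrK.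
Qed.

Lemma sinD2piz (R : realType) (x : R) (k : int) :
  sin (x + pi *+ 2 * k%:~R) = sin x.
Proof. by rewrite -!cosBpihalf addrAC cosD2piz. Qed.

Lemma ler_norm_sin (R : realType) (x : R) : `|sin x| <= `|x|.
Proof.
wlog x0 : x / 0 <= x => [sinle|].
  have [/sinle//|/ltW x0] := leP 0 x.
  by rewrite -(normrN x) -(normrN (sin x)) -sinN sinle// oppr_ge0.
have [|c _] := @MVT_segment R sin cos 0 x x0.
  exact/continuous_subspaceT/continuous_sin.
by rewrite sin0 !subr0 => ->; rewrite normrM ler_piMl// cos_max.
Qed.

(** Multiplying by [2 * sin a], where [a] is half the angle step, makes the sum telescope;
    [0 < |m| < N] gives [0 < |a| < pi], so [sin a] can be cancelled. *)
Lemma sum_cos_eq0 (R : realType) (N : nat) (m : int) : m != 0 -> `|m| < N%:Z ->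
  \sum_(j < N) cos (pi *+ 2 * j%:R / N%:R * m%:~R) = 0 :> R.
Proof.
move=> m0 mN; have N0 : (0 < N%:R :> R).
  by rewrite ltr0n -ltz_nat (le_lt_trans _ mN).
pose a : R := pi * m%:~R / N%:R.
have a0 : sin a != 0.
  have /sin_gt0_pi : 0 < `|a| < pi.
    rewrite normr_gt0 !mulf_neq0 ?invr_neq0 ?intr_eq0 ?(gt_eqF N0) ?(gt_eqF (pi_gt0 R))//=.
    rewrite normrM normfV (gtr0_norm N0) ltr_pdivrMr// normrM (gtr0_norm (pi_gt0 R)).
    by rewrite ltr_pM2l ?pi_gt0// -intr_norm (ltr_int R _ N).
  by case: (ger0P a); rewrite ?sinN ?oppr_gt0 => _ sa; [exact: lt0r_neq0|exact: ltr0_neq0].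
apply: (mulfI (mulf_neq0 (_ : 2 != 0) a0)); rewrite ?pnatr_eq0// mulr0.
rewrite -(big_mkord predT (fun j => cos (pi *+ 2 * j%:R / N%:R * m%:~R))) mulr_sumr.
(* 2 sin(a) cos(2aj) = sin((2j + 1)a) - sin((2j - 1)a) telescopes. *)
pose f j : R := sin (a *+ 2 * j%:R - a).
rewrite (eq_bigr (fun j => f j.+1 - f j)) => [|j _]; last first.
  rewrite /f (_ : a *+ 2 * j.+1%:R - a = a *+ 2 * j%:R + a); last by rewrite -natr1; ring.
  rewrite (_ : _ * m%:~R = a *+ 2 * j%:R); last by rewrite /a; field; rewrite gt_eqF.
  by rewrite sinB sinD; ring.
(* The arguments of [f N] and [f 0] differ by [m] full periods. *)
rewrite telescope_sumr// /f mulr0 sub0r.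
rewrite (_ : _ - a = - a + pi *+ 2 * m%:~R) ?sinD2piz ?subrr//.
by rewrite /a; field; rewrite gt_eqF.
Qed.

(** * Riesz products and their means over equally spaced angles *)

Section RieszProduct.
Variable R : realType.
Implicit Types (s : seq int) (m : int).

(** The variable [x] is the angle [2 pi t]; frequencies are listed so that factors can be split off
    by induction. *)
Definition riesz s (x : R) : R := \prod_(v <- s) (1 - cos (x * v%:~R)).

Definition sample N j : R := pi *+ 2 * j%:R / N%:R.

Definition signed (eps : int -> int) := forall v, eps v \in [:: -1; 0; 1].

Lemma riesz_ge0 s x : 0 <= riesz s x.
Proof. by apply: prodr_ge0 => v _; rewrite subr_ge0 cos_le1. Qed.

Lemma riesz_cons v s x : riesz (v :: s) x = (1 - cos (x * v%:~R)) * riesz s x.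
Proof. by rewrite /riesz big_cons. Qed.

Lemma riesz_rem v s x : v \in s ->
  riesz s x = (1 - cos (x * v%:~R)) * riesz (rem v s) x.
Proof. by move=> vs; rewrite /riesz (perm_big _ (perm_to_rem vs)) big_cons. Qed.

(** As [v] is not in [s], overriding [eps] at [v] leaves the sum over [s] intact. This carries sign
    choices on [s] over to [v :: s]. *)
Lemma signed_sum_cons eps (e v : int) s : uniq (v :: s) -> signed eps ->
    e \in [:: -1; 0; 1] ->
  exists2 eps', signed eps' &
    [/\ eps' v = e, {in s, eps' =1 eps} &
      \sum_(w <- v :: s) eps' w * w = e * v + \sum_(w <- s) eps w * w].
Proof.
move=> /= /andP[vs _] epsS eS.
have epsE : {in s, (fun w => if w == v then e else eps w) =1 eps}.
  by move=> w ws /=; case: eqP => // wv; rewrite -wv ws in vs.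
exists (fun w => if w == v then e else eps w); first by move=> w /=; case: eqP.
split=> //; first by rewrite eqxx.
by rewrite big_cons eqxx; congr (_ + _); apply: eq_big_seq => w /epsE ->.
Qed.

(** The second hypothesis says that no frequency of the expansion vanishes, the third that none
    reaches [N] in absolute value, so [sum_cos_eq0] kills each term. *)
Lemma sum_riesz_cos N s m : uniq s ->
    (forall eps, signed eps -> m + \sum_(v <- s) eps v * v != 0) ->
    `|m| + \sum_(v <- s) `|v| < N%:Z ->
  \sum_(j < N) riesz s (sample N j) * cos (sample N j * m%:~R) = 0.
Proof.
elim: s m => [|v s IH] m us ms mN.
  under eq_bigr do rewrite /riesz big_nil mul1r.
  apply: sum_cos_eq0; last by rewrite big_nil addr0 in mN.
  by have := ms (fun=> 0) (fun=> isT); rewrite big_nil addr0.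
(* The factor of [v] turns the frequency [m] into [m], [m + v] and [m - v]; the induction hypothesis
   covers all three, [|v|] moving from the sum into the bound on the new frequency. *)
have shift (e : int) : e \in [:: -1; 0; 1] ->
    \sum_(j < N) riesz s (sample N j) * cos (sample N j * (m + e * v)%:~R) = 0.
  move=> eS; apply: IH; first by case/andP: us.
    move=> eps epsS; have [eps' eps'S [_ _ sumE]] := signed_sum_cons us epsS eS.
    by rewrite -addrA -sumE ms.
  apply: le_lt_trans mN; rewrite big_cons addrA lerD2r.
  apply: le_trans (ler_normD _ _) _; rewrite lerD2l normrM ler_piMl//.
  by move: eS; rewrite !inE => /or3P[] /eqP->.
have plus := shift 1 isT; have minus := shift (-1) isT.
have zero := shift 0 isT; rewrite mul0r addr0 in zero.
(* Product-to-sum formula for [cos (x * v) * cos (x * m)]. *)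
rewrite (eq_bigr (fun j : 'I_N =>
    riesz s (sample N j) * cos (sample N j * m%:~R) -
    2^-1 * (riesz s (sample N j) * cos (sample N j * (m + 1 * v)%:~R) +
            riesz s (sample N j) * cos (sample N j * (m + (-1) * v)%:~R)))).
  by rewrite sumrB -mulr_sumr big_split /= zero plus minus addr0 mulr0 subr0.
move=> j _; rewrite riesz_cons mul1r mulN1r !rmorphD rmorphN /= !mulrDr mulrN.
by rewrite cosB cosD; field.
Qed.

Definition dissociated_seq s := forall eps, signed eps ->
  \sum_(v <- s) eps v * v = 0 -> {in s, forall v, eps v = 0}.

(** A relation on [s] extends to [v :: s] with coefficient 0 at [v]. *)
Lemma dissociated_seq_cons v s : uniq (v :: s) ->
  dissociated_seq (v :: s) -> dissociated_seq s.
Proof.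
move=> us ds eps epsS eps0 w ws.
have [eps' eps'S [_ epsE sumE]] := signed_sum_cons (e := 0) us epsS isT.
by rewrite -epsE// (ds _ eps'S) ?inE ?ws ?orbT// sumE mul0r add0r.
Qed.

Lemma dissociated_seq_rem v s : uniq s -> v \in s ->
  dissociated_seq s -> dissociated_seq (rem v s).
Proof.
move=> us vs ds; have sE := perm_to_rem vs.
apply: (@dissociated_seq_cons v); first by rewrite -(perm_uniq sE).
move=> eps epsS; rewrite -(perm_big _ sE) => /ds eps0 w.
by rewrite -(perm_mem sE); apply: eps0.
Qed.

Lemma sum_riesz N s : uniq s -> dissociated_seq s ->
    \sum_(v <- s) `|v| < N%:Z ->
  \sum_(j < N) riesz s (sample N j) = N%:R.
Proof.
elim: s => [|v s IH] us ds sN.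
  under eq_bigr do rewrite /riesz big_nil.
  by rewrite sumr_const card_ord.
under eq_bigr do rewrite riesz_cons mulrC mulrBr mulr1.
rewrite sumrB IH; last 3 first.
- by case/andP: us.
- exact: dissociated_seq_cons ds.
- by apply: le_lt_trans sN; rewrite big_cons lerDr.
rewrite sum_riesz_cos ?subr0//; first by case/andP: us.
  (* A vanishing frequency would be a relation on [v :: s] with coefficient 1 at [v]. *)
  move=> eps epsS; have [eps' eps'S [eps'v _ sumE]] :=
    signed_sum_cons (e := 1) us epsS isT.
  apply/eqP => sum0; have := ds _ eps'S; rewrite sumE mul1r => /(_ sum0 v).
  by rewrite mem_head eps'v => /(_ isT).
by rewrite big_cons in sN.
Qed.

Lemma exists_cos_gap s : s != [::] -> uniq s -> dissociated_seq s ->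
  exists x : R, {in s, forall v, 1 < (size s).*2%:R * (1 - cos (x * v%:~R))}.
Proof.
move=> s0 us ds; pose N := (\sum_(v <- s) `|v|%N).+1.
have sN : \sum_(v <- s) `|v| < N%:Z.
  rewrite /N -addn1 PoszD ltzD1 (big_morph Posz PoszD (erefl _)).
  by apply: ler_sum => v _; rewrite abszE.
have n0 : (0 < size s)%N by rewrite lt0n size_eq0.
have sumP := sum_riesz us ds sN.
have sumQ : \sum_(j < N) \sum_(v <- s) riesz (rem v s) (sample N j) =
    (size s)%:R * N%:R.
  rewrite exchange_big /= (eq_big_seq (fun=> N%:R)) => [|v vs].
    by rewrite big_const_seq count_predT iter_addr_0 mulr_natl.
  apply: sum_riesz; [exact: rem_uniq|exact: dissociated_seq_rem|].
  by apply: le_lt_trans sN; rewrite (perm_big _ (perm_to_rem vs)) big_cons lerDr.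
(* Otherwise summing over [j] would give [2 n N <= n N], where [n] is [size s]. *)
have [j jP] : exists j : 'I_N, \sum_(v <- s) riesz (rem v s) (sample N j) <
    (size s).*2%:R * riesz s (sample N j).
  apply: contrapT => /forallNP noj.
  have : (size s).*2%:R * N%:R <= (size s)%:R * N%:R :> R.
    rewrite -sumQ -{1}sumP mulr_sumr; apply: ler_sum => j _.
    by rewrite leNgt; apply/negP/noj.
  by rewrite ler_pM2r ?ltr0n// ler_nat -addnn -{3}[size s]addn0 leq_add2l leqNgt n0.
exists (sample N j) => v vs; move: jP; rewrite (riesz_rem _ vs) mulrA.
set Q := riesz (rem v s) _; set C := _ * (1 - _) => jP.
(* [Q] is one term of a sum of nonnegative terms; the strict inequality then excludes [Q = 0], so
   [Q] cancels. *)
have QC : Q < C * Q.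
  apply: le_lt_trans jP; rewrite (perm_big _ (perm_to_rem vs)) big_cons lerDl.
  by apply: sumr_ge0 => w _; exact: riesz_ge0.
have Q0 : 0 < Q.
  rewrite lt0r riesz_ge0 andbT; apply: contraTneq QC => ->.
  by rewrite mulr0 ltxx.
by rewrite -(ltr_pM2r Q0) mul1r.
Qed.

(** For [k] an integer nearest to [x], the left side is [2 sin^2 (pi (x - k))], and
    [|sin u| <= |u|]. *)
Lemma subr1_cos_le_distT (x : R) : 1 - cos (pi *+ 2 * x) <= 2 * (pi * distT x) ^+ 2.
Proof.
have [k ->] := distT_attained x.
have -> : cos (pi *+ 2 * x) = cos ((pi * (x - k%:~R)) *+ 2).
  by rewrite -[RHS](cosD2piz _ k); congr cos; ring.
have := ler_norm_sin (pi * (x - k%:~R)).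
rewrite -ler_sqr ?nnegrE// normrM (gtr0_norm (pi_gt0 R)).
rewrite real_normK ?num_real// => sinle.
by rewrite cos_mulr2n cos2sin2; lra.
Qed.

End RieszProduct.

(** * Return to finite sets and the bound on [ML] *)

Lemma dissociated_fset (V : {fset int}) :
  dissociated [set` V]%classic -> dissociated_seq (enum_fset V).
Proof.
move=> dV eps epsS sum0 v vV; apply: dV => //.
  apply: (sub_finite_set (B := [set` V]%classic)) => [w []//|].
  exact: finite_fset.
by rewrite -(fsbig_seq _ _ (fset_uniq V)).
Qed.

Theorem lemma4p1 (R : realType) :
  exists2 c : R, 0 < c &
    forall (n : nat) (V : {fset int}),
      (0 < n)%N ->
      #|` V| = n ->
      (forall v : int, v \in V -> 0 < v) ->
      dissociated [set` V]%classic ->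
      c / Num.sqrt n%:R <= ML R V.
Proof.
have tau0 : 0 < pi *+ 2 :> R by rewrite pmulrn_lgt0 ?pi_gt0.
(* The constant comes from [1 < 2 n (1 - cos (2 pi y)) <= n (2 pi d)^2], where [d] is [distT y]. *)
exists (pi *+ 2)^-1 => [|n V n0 Vn _ dV]; first by rewrite invr_gt0.
have V0 : V != fset0 by rewrite -cardfs_gt0 Vn.
have [x xP] : exists x : R, {in V, forall v, 1 < n.*2%:R * (1 - cos (x * v%:~R))}.
  rewrite -Vn; apply: exists_cos_gap (fset_uniq V) (dissociated_fset dV).
  by rewrite -size_eq0 -lt0n -/(#|` V|) Vn.
have [_ MLmax] := ML_attained R V0.
apply: le_trans (MLmax (x / (pi *+ 2))).
have [v vV ->] := minDist_attained (x / (pi *+ 2)) V0.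
set y := _ * _%:~R; have yE : x * v%:~R = pi *+ 2 * y.
  by rewrite /y mulrA mulrCA divff ?mulr1// gt_eqF.
have := xP v vV; rewrite yE.
have := subr1_cos_le_distT y.
set d := distT y => cosd gap.
have n0R : 0 < n%:R :> R by rewrite ltr0n.
have sq0 : 0 < Num.sqrt n%:R :> R by rewrite sqrtr_gt0.
rewrite ler_pdivrMr// -[leLHS]mul1r ler_pdivrMr//.
rewrite -ler_sqr ?nnegrE ?mulr_ge0 ?distT_ge0 ?ltW//.
rewrite expr1n !exprMn sqr_sqrtr ?ler0n//.
apply: lt_le_trans gap _.
rewrite -muln2 natrM -mulrA.
apply: le_trans (ler_wpM2l _ (ler_wpM2l _ cosd)) _ => //.
by rewrite le_eqVlt; apply/orP; left; apply/eqP; ring.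
Qed.
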